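(* Let $(V,g)$ be a Euclidean real vector space of dimension $n$, let $\omega$ be a symmetric $(p,p)$ double form on $V$ ($p\geq 1$) satisfying the first Bianchi identity, and let $q$ be a positive integer. For $0\le r\le n-pq$ put $h_{(r,pq)}(\omega)=*\frac{g^{n-pq-r}\omega^q}{(n-pq-r)!}$. Then for $1\le r\le n-pq$, $$\mathrm c\bigl(h_{(r,pq)}(\omega)\bigr)=(n-pq-r+1)\,h_{(r-1,pq)}(\omega).$$
   Context: Let $(V,g)$ be a Euclidean real vector space of dimension $n$. A $(p,q)$ double form is an element of $\mathcal D^{p,q}=\Lambda^pV^*\otimes\Lambda^qV^*$, identified with a bilinear form $\Lambda^pV\times\Lambda^qV\to\mathbb R$. Exterior product: $(\theta_1\otimes\theta_2)(\theta_3\otimes\theta_4)=(\theta_1\wedge\theta_3)\otimes(\theta_2\wedge\theta_4)$, extended bilinearly; products and powers in the claim are exterior products, with zeroth power $1$; $g$ is regarded as a $(1,1)$ double form. Contraction $\mathrm c:\mathcal D^{p,q}\to\mathcal D^{p-1,q-1}$: $\mathrm c\,\omega(x_1\wedge\dots\wedge x_{p-1},y_1\wedge\dots\wedge y_{q-1})=\sum_{j=1}^n\omega(e_j\wedge x_1\wedge\dots\wedge x_{p-1},e_j\wedge y_1\wedge\dots\wedge y_{q-1})$ for any orthonormal basis $(e_j)$. Double Hodge star: for a $(p,p)$ double form $\omega$, $*\omega$ is the $(n-p,n-p)$ double form $*\omega(u,v)=\omega( *u,*v)$, with $*$ on the right the usual Hodge star $\Lambda^{n-p}V\to\Lambda^{p}V$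 for some chosen orientation (the result does not depend on it). A $(0,0)$ double form is a scalar. A $(p,p)$ double form $\omega$ is symmetric if $\omega(u,v)=\omega(v,u)$ for $u,v\in\Lambda^pV$, and satisfies the first Bianchi identity if $\sum_{j=1}^{p+1}(-1)^j\omega(x_1\wedge\dots\widehat{x_j}\dots\wedge x_{p+1},\;x_j\wedge y_1\wedge\dots\wedge y_{p-1})=0$ for all vectors $x_1,\dots,x_{p+1},y_1,\dots,y_{p-1}\in V$. *)

(* Defs.v *)
From HB Require Import structures.
From mathcomp Require Import all_boot all_order all_algebra.
From mathcomp Require Import sesquilinear.
From mathcomp Require Import reals.

Set Implicit Arguments.
Unset Strict Implicit.
Unset Printing Implicit Defensive.

Import Order.TTheory GRing.Theory Num.Theory.
Local Open Scope ring_scope.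

(* Encoding. A linear form on /\^p V is an alternating p-linear map, and a
   bilinear form on /\^p V x /\^q V is a map of p + q vectors that is alternating
   multilinear in the first p and in the last q. To avoid casts between degrees,
   (double) forms of all degrees live in one type of functions on finite
   sequences of vectors: w x y is the value of w on
   (x_1 /\ .. /\ x_k, y_1 /\ .. /\ y_l), and a form of bidegree (p, q) vanishes
   on sequences whose sizes are not (p, q). *)

Section Forms.
Variables (R : comNzRingType) (V : lmodType R).

Definition form : Type := seq V -> R.
Definition dform : Type := seq V -> seq V -> R.

Definition multilinear (a : form) : Prop :=
  forall (s t : seq V) (c : R) (u v : V),
    a (s ++ (c *: u + v) :: t) = c * a (s ++ u :: t) + a (s ++ v :: t).

Definition alternating (a : form) : Prop :=
  forall (s t w : seq V) (u : V), a (s ++ u :: t ++ u :: w) = 0.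

Definition is_dform (p q : nat) (w : dform) : Prop :=
  [/\ forall x y, ~~ ((size x == p) && (size y == q)) -> w x y = 0,
      forall y, multilinear (w^~ y) /\ alternating (w^~ y)
    & forall x, multilinear (w x) /\ alternating (w x)].

(* A subset I of {1,..,k} is a bit mask m; inversions m is the number of pairs
   i < j with i \notin I and j \in I, so that (-1) ^+ inversions m is the sign of
   the permutation listing first I, then its complement, in increasing order. *)
Fixpoint inversions (m : bitseq) : nat :=
  if m is b :: m' then ((if b then 0 else count id m') + inversions m')%N
  else 0%N.

Definition shuffle_sign (m : bitseq) : R := (-1) ^+ inversions m.

Definition maskC (m : bitseq) (x : seq V) : seq V := mask (map negb m) x.

(* Normalised so that (a_1 /\ .. /\ a_k)(x_1, .., x_k) = \det (a_i(x_j)). *)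
Definition wedge (a b : form) : form := fun x =>
  \sum_(m : (size x).-tuple bool)
    shuffle_sign m * (a (mask m x) * b (maskC m x)).

Definition dtensor (a b : form) : dform := fun x y => a x * b y.

(* The bilinear extension of
   (a (x) b) (c (x) d) = (a /\ c) (x) (b /\ d): see dmul_tensor below. *)
Definition dmul (w1 w2 : dform) : dform := fun x y =>
  \sum_(m : (size x).-tuple bool) \sum_(m' : (size y).-tuple bool)
    shuffle_sign m * shuffle_sign m' *
    (w1 (mask m x) (mask m' y) * w2 (maskC m x) (maskC m' y)).

Definition dadd (w1 w2 : dform) : dform := fun x y => w1 x y + w2 x y.
Definition dscale (c : R) (w : dform) : dform := fun x y => c * w x y.

Definition dform1 : dform := fun x y => (nilp x && nilp y)%:R.

Definition dpow (w : dform) (k : nat) : dform := iter k (dmul w) dform1.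

Lemma dmul_tensor (a b c d : form) (x y : seq V) :
  dmul (dtensor a b) (dtensor c d) x y = dtensor (wedge a c) (wedge b d) x y.
Proof.
rewrite /dmul /dtensor /wedge big_distrl /=; apply: eq_bigr => m _.
rewrite big_distrr /=; apply: eq_bigr => m' _.
by rewrite [RHS]mulrACA; congr (_ * _); rewrite mulrACA.
Qed.

Lemma dmul_linear_l (k : R) (w1 w2 w : dform) (x y : seq V) :
  dmul (dadd (dscale k w1) w2) w x y =
  dadd (dscale k (dmul w1 w)) (dmul w2 w) x y.
Proof.
rewrite /dmul /dadd /dscale big_distrr -big_split /=; apply: eq_bigr => m _.
rewrite big_distrr -big_split /=; apply: eq_bigr => m' _.
by rewrite mulrDl mulrDr; congr (_ + _); rewrite -(mulrA k) mulrCA.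
Qed.

Lemma dmul_linear_r (k : R) (w w1 w2 : dform) (x y : seq V) :
  dmul w (dadd (dscale k w1) w2) x y =
  dadd (dscale k (dmul w w1)) (dmul w w2) x y.
Proof.
rewrite /dmul /dadd /dscale big_distrr -big_split /=; apply: eq_bigr => m _.
rewrite big_distrr -big_split /=; apply: eq_bigr => m' _.
rewrite !mulrDr; congr (_ + _).
by rewrite [X in _ * X = _](mulrCA _ k) (mulrCA _ k).
Qed.

(* A multivector, as a formal linear combination of decomposable ones: (c, x)
   stands for c *: (x_1 /\ .. /\ x_k). *)
Definition multivector : Type := seq (R * seq V).

Definition deval (w : dform) (u v : multivector) : R :=
  \sum_(a <- u) \sum_(b <- v) a.1 * b.1 * w a.2 b.2.

Definition dsymmetric (w : dform) : Prop := forall x y, w x y = w y x.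

Definition first_bianchi (p : nat) (w : dform) : Prop :=
  forall x y : seq V, size x = p.+1 -> size y = p.-1 ->
    \sum_(j < p.+1)
      (-1) ^+ j.+1 * w (take j x ++ drop j.+1 x) (nth 0 x j :: y) = 0.

End Forms.

Section Euclidean.
Variables (R : realType) (V : vectType R) (g : {dot V for (@idfun R)}).

Definition orthonormal_basis (n : nat) (e : n.-tuple V) : Prop :=
  basis_of {:V}%VS e /\ orthonormal g e.

Definition metric_dform : dform V := fun x y =>
  if (x, y) is ([:: u], [:: v]) then g u v else 0.

(* The inner product of x_1 /\ .. /\ x_k and y_1 /\ .. /\ y_l; multivectors of
   different degrees are orthogonal. *)
Definition gram (x y : seq V) : R :=
  if size x == size y then
    \det (\matrix_(i < size x, j < size x) g (nth 0 x i) (nth 0 y j))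
  else 0.

Variable (n : nat).

Definition contraction (e : n.-tuple V) (w : dform V) : dform V := fun x y =>
  \sum_(j < n) w (tnth e j :: x) (tnth e j :: y).

(* The Hodge star of x_1 /\ .. /\ x_k for the orientation of the orthonormal
   basis e. With e_I the wedge of the e_i, i \in I, in increasing order, the
   characteristic property u /\ *v = <u, v> vol says that
   *e_I = s(I) e_(~I), where s(I) is the sign with e_I /\ e_(~I) = s(I) vol;
   this is extended linearly through v = \sum_I <v, e_I> e_I. *)
Definition hodge (e : n.-tuple V) (x : seq V) : multivector V :=
  [seq (gram x (mask m e) * shuffle_sign R m, maskC m e)
     | m : n.-tuple bool].

Definition dhodge (e : n.-tuple V) (w : dform V) : dform V := fun x y =>
  deval w (hodge e x) (hodge e y).

(* Only meant for r + p * q <= n, where the subtractions are not truncated. *)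
Definition h_form (e : n.-tuple V) (p q : nat) (w : dform V) (r : nat) :
    dform V :=
  dhodge e
    (dscale ((n - p * q - r)`!%:R^-1)
      (dmul (dpow metric_dform (n - p * q - r)) (dpow w q))).

End Euclidean.

(* Main.v *)
Require Import Defs.
From mathcomp Require Import all_boot all_order all_algebra.
From mathcomp Require Import sesquilinear reals boolp.
From mathcomp Require Import ring.

Import Order.TTheory GRing.Theory Num.Theory.
Local Open Scope ring_scope.

Set Implicit Arguments.
Unset Strict Implicit.
Unset Printing Implicit Defensive.

(* The double Hodge star is a top-degree exterior product: with e the oriented
   orthonormal basis and G_x = <x, .> the Gram form of a decomposable multivector
   x, one has *w (x, y) = ((G_x (x) G_y) w)(e, e). Row expansion of the Gram
   determinant reads G_(u /\ x) = <u, .> /\ G_x, and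
   \sum_j <f_j, .> (x) <f_j, .> = g for every orthonormal basis f, so
     c( *w )(x, y) = (g (G_x (x) G_y) w)(e, e).
   Moving g past G_x (x) G_y costs the sign (-1)^(|x| + |y|), which is 1 unless
   both sides vanish for degree reasons; hence c * w = * (g w) for every w
   supported in bidegrees (k, k). Apply this to w = g^k omega^q / k!. *)

(** * Sums over bit masks, and degree signs *)

Lemma big_tuple_cons (R : nmodType) (T : finType) (k : nat)
  (F : seq T -> R) :
  \sum_(m : k.+1.-tuple T) F m = \sum_(b : T) \sum_(m : k.-tuple T) F (b :: m).
Proof.
rewrite pair_big /=.
rewrite (reindex (fun p : T * k.-tuple T => [tuple of p.1 :: p.2])) //=.
exists (fun t : k.+1.-tuple T => (thead t, [tuple of behead t])) => [[b m] _|t _].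
  by congr (_, _); apply: val_inj.
by rewrite /= [RHS]tuple_eta; apply: val_inj.
Qed.

Lemma big_tuple0 (R : nmodType) (T : finType) (F : seq T -> R) :
  \sum_(m : 0.-tuple T) F m = F [::].
Proof.
rewrite (bigD1 [tuple]) //= big1 ?addr0 // => m /eqP[].
exact: tuple0.
Qed.

Definition iprod {R : comNzRingType} {V : lmodType R} (u : V) (a : Defs.form V) :
  Defs.form V := fun x => a (u :: x).

(** The grading involution: the sign picked up when a vector moves past [a]. *)
Definition twist {R : comNzRingType} {V : lmodType R} (a : Defs.form V) :
  Defs.form V := fun x => (-1) ^+ size x * a x.

Lemma size_mask_maskC (R : comNzRingType) (V : lmodType R) (m : bitseq)
  (x : seq V) :
  size m = size x -> (size (mask m x) + size (maskC m x))%N = size x.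
Proof.
move=> mx; rewrite !size_mask ?size_map // count_map -mx.
exact: count_predC.
Qed.

Lemma sign_mask_maskC (R : comNzRingType) (V : lmodType R) (m : bitseq)
  (x : seq V) :
  size m = size x ->
  (-1) ^+ size x = (-1) ^+ size (mask m x) * (-1) ^+ size (maskC m x) :> R.
Proof. by move=> mx; rewrite -exprD size_mask_maskC. Qed.

(** * Exterior product of forms *)

Section Wedge.
Context {R : comNzRingType} {V : lmodType R}.
Implicit Types (a b c : Defs.form V) (x y : seq V) (u v : V).

Lemma wedge_nil a b : wedge a b [::] = a [::] * b [::].
Proof.
rewrite /wedge (big_tuple0 (fun m =>
  shuffle_sign R m * (a (mask m [::]) * b (maskC m [::])))).
by rewrite /shuffle_sign expr0 mul1r.
Qed.

(* The interior product by u is an antiderivation: this turns identities between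
   exterior products into inductions on the list of arguments. *)
Lemma wedge_cons a b u x :
  wedge a b (u :: x) = wedge (iprod u a) b x + wedge (twist a) (iprod u b) x.
Proof.
rewrite /wedge.
rewrite (big_tuple_cons _ (fun m =>
  shuffle_sign R m * (a (mask m (u :: x)) * b (maskC m (u :: x))))).
(* The head of the mask decides which factor receives [u]. If it is [b], then [u] is inverted with
   every entry of [mask m x], whence [twist a]. *)
rewrite big_bool; congr (_ + _); apply: eq_bigr => m _.
rewrite /shuffle_sign /twist /= size_mask ?size_tuple // exprD.
by rewrite -!mulrA mulrCA.
Qed.

Lemma wedgeDl a b c :
  wedge (fun x => a x + b x) c = (fun x => wedge a c x + wedge b c x).
Proof.
apply: funext => x; rewrite /wedge -big_split; apply: eq_bigr => m _ /=.
by rewrite mulrDl mulrDr.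
Qed.

Lemma wedgeDr a b c :
  wedge a (fun x => b x + c x) = (fun x => wedge a b x + wedge a c x).
Proof.
apply: funext => x; rewrite /wedge -big_split; apply: eq_bigr => m _ /=.
by rewrite !mulrDr.
Qed.

Lemma twist_wedge a b : twist (wedge a b) = wedge (twist a) (twist b).
Proof.
apply: funext => x; rewrite /twist /wedge big_distrr; apply: eq_bigr => m _ /=.
by rewrite (sign_mask_maskC (size_tuple m)); ring.
Qed.

(** Peeling off the first argument splits both sides into three terms, one for each factor that may
    receive it; [twist_wedge] matches the signs when it goes to [c]. *)
Lemma wedgeA a b c : wedge a (wedge b c) = wedge (wedge a b) c.
Proof.
apply: funext => x; elim: x a b c => [|u x IH] a b c.
  by rewrite !wedge_nil mulrA.
rewrite !wedge_cons.
have iprodE a' b' : iprod u (wedge a' b') =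
    fun x => wedge (iprod u a') b' x + wedge (twist a') (iprod u b') x.
  by apply: funext => z; rewrite /iprod wedge_cons.
by rewrite !iprodE wedgeDl wedgeDr twist_wedge !IH addrA.
Qed.

(** Needed because an interior product lowers a linear form to degree 0. *)
Lemma wedge_scalar a b :
  (forall x, size x != 0 -> a x = 0) -> wedge a b = fun x => a [::] * b x.
Proof.
move=> a0; apply: funext => x; elim: x a b a0 => [|u x IH] a b a0.
  by rewrite wedge_nil.
rewrite wedge_cons !IH.
- by rewrite /iprod a0 // mul0r add0r /twist expr0 mul1r.
- by move=> z zn0; rewrite /twist a0 ?mulr0.
- by move=> z _; rewrite /iprod a0.
Qed.

Lemma wedge_scalar_r a b :
  (forall x, size x != 0 -> b x = 0) -> wedge a b = fun x => b [::] * a x.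
Proof.
move=> b0; apply: funext => x; elim: x a b b0 => [|u x IH] a b b0.
  by rewrite wedge_nil mulrC.
rewrite wedge_cons !IH.
- by rewrite /iprod (b0 [:: u]) // mul0r addr0.
- by move=> z _; rewrite /iprod b0.
- by move=> z zn0; rewrite b0.
Qed.

Lemma iprod_linear_form a u :
  (forall x, size x != 1 -> a x = 0) ->
  forall x, size x != 0 -> iprod u a x = 0.
Proof. by move=> a1 x x0; rewrite /iprod a1. Qed.

Lemma twist_linear_form a :
  (forall x, size x != 1 -> a x = 0) -> twist a = fun x => - a x.
Proof.
move=> a1; apply: funext => x; rewrite /twist.
by have [->|/a1->] := eqVneq (size x) 1; rewrite ?expr1 ?mulN1r ?mulr0 ?oppr0.
Qed.

Lemma wedgeNl a b : wedge (fun x => - a x) b = fun x => - wedge a b x.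
Proof.
apply: funext => x; rewrite /wedge -sumrN; apply: eq_bigr => m _.
by rewrite mulNr mulrN.
Qed.

Lemma wedgeZl k a b :
  wedge (fun x => k * a x) b = fun x => k * wedge a b x.
Proof.
apply: funext => x; rewrite /wedge big_distrr; apply: eq_bigr => m _ /=; ring.
Qed.

Lemma wedge_linear_formC a b :
  (forall x, size x != 1 -> a x = 0) -> wedge a b = wedge (twist b) a.
Proof.
move=> a1; apply: funext => x; elim: x b => [|u x IH] b.
  by rewrite !wedge_nil /twist expr0 mul1r mulrC.
(* [addrC] pairs the terms in which [b] receives [u], then those in which [a] does. In the former,
   the minus sign is the extra degree of [u :: z] in [twist b]; in the latter, [b] is twisted
   twice. *)
rewrite !wedge_cons addrC twist_linear_form // wedgeNl IH; congr (_ + _).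
  rewrite -[LHS]/((fun x => - wedge _ a x) x) -wedgeNl.
  congr (wedge _ a x); apply: funext => z.
  by rewrite /twist /iprod /= exprS mulN1r mulNr.
rewrite wedge_scalar ?wedge_scalar_r; try exact: iprod_linear_form.
by rewrite /twist mulrA -exprD addnn -mul2n exprM sqrrN !expr1n mul1r.
Qed.

(** This has the shape of a Laplace expansion along the first row, for comparison with the Gram
    determinant. *)
Lemma wedge_linear_form a b x :
  (forall x, size x != 1 -> a x = 0) ->
  wedge a b x = \sum_(0 <= i < size x)
    (-1) ^+ i * (a [:: nth 0 x i] * b (take i x ++ drop i.+1 x)).
Proof.
move=> a1; elim: x b => [|u x IH] b.
  by rewrite wedge_nil big_geq // a1 // mul0r.
rewrite wedge_cons wedge_scalar; last exact: iprod_linear_form.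
rewrite twist_linear_form // wedgeNl IH big_nat_recl //= expr0 mul1r drop0.
congr (_ + _); rewrite -sumrN; apply: eq_bigr => i _.
by rewrite exprS mulN1r mulNr.
Qed.

End Wedge.

(** * Exterior product of double forms *)

Section DoubleForms.
Context {R : comNzRingType} {V : lmodType R}.
Implicit Types (w : dform V) (a b c d : Defs.form V) (x y : seq V) (u v : V).

(** Only the first list contributes to the sign, since [dmul_cons] peels that list alone. *)
Definition dtwist w : dform V := fun x y => (-1) ^+ size x * w x y.

Lemma dmul_nil w1 w2 y : dmul w1 w2 [::] y = wedge (w1 [::]) (w2 [::]) y.
Proof.
rewrite /dmul (big_tuple0 (fun m => \sum_(m' : (size y).-tuple bool)
  shuffle_sign R m * shuffle_sign R m' *
  (w1 (mask m [::]) (mask m' y) * w2 (maskC m [::]) (maskC m' y)))).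
by apply: eq_bigr => m' _; rewrite /shuffle_sign expr0 mul1r.
Qed.

Lemma dmul_cons w1 w2 u x y :
  dmul w1 w2 (u :: x) y =
  dmul (fun z => w1 (u :: z)) w2 x y +
  dmul (dtwist w1) (fun z => w2 (u :: z)) x y.
Proof.
rewrite /dmul (big_tuple_cons _ (fun m => \sum_(m' : (size y).-tuple bool)
  shuffle_sign R m * shuffle_sign R m' *
  (w1 (mask m (u :: x)) (mask m' y) * w2 (maskC m (u :: x)) (maskC m' y)))).
rewrite big_bool; congr (_ + _); apply: eq_bigr => m _.
apply: eq_bigr => m' _.
rewrite /shuffle_sign /dtwist /= size_mask ?size_tuple // exprD.
ring.
Qed.

Lemma dmulDl w1 w2 w :
  dmul (fun x y => w1 x y + w2 x y) w =
  fun x y => dmul w1 w x y + dmul w2 w x y.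
Proof.
apply: funext => x; apply: funext => y; rewrite /dmul -big_split.
apply: eq_bigr => m _; rewrite -big_split; apply: eq_bigr => m' _ /=; ring.
Qed.

Lemma dmulDr w w1 w2 :
  dmul w (fun x y => w1 x y + w2 x y) =
  fun x y => dmul w w1 x y + dmul w w2 x y.
Proof.
apply: funext => x; apply: funext => y; rewrite /dmul -big_split.
apply: eq_bigr => m _; rewrite -big_split; apply: eq_bigr => m' _ /=; ring.
Qed.

Lemma dmulZr k w1 w2 : dmul w1 (dscale k w2) = dscale k (dmul w1 w2).
Proof.
apply: funext => x; apply: funext => y; rewrite /dmul /dscale big_distrr.
apply: eq_bigr => m _; rewrite big_distrr; apply: eq_bigr => m' _ /=; ring.
Qed.

Lemma dmul_suml n (W : 'I_n -> dform V) w :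
  dmul (fun x y => \sum_(j < n) W j x y) w =
  fun x y => \sum_(j < n) dmul (W j) w x y.
Proof.
apply: funext => x; apply: funext => y; rewrite /dmul [RHS]exchange_big.
apply: eq_bigr => m _; rewrite [RHS]exchange_big; apply: eq_bigr => m' _ /=.
by rewrite big_distrl big_distrr.
Qed.

Lemma dmul_sumr n (W : 'I_n -> dform V) w :
  dmul w (fun x y => \sum_(j < n) W j x y) =
  fun x y => \sum_(j < n) dmul w (W j) x y.
Proof.
apply: funext => x; apply: funext => y; rewrite /dmul [RHS]exchange_big.
apply: eq_bigr => m _; rewrite [RHS]exchange_big; apply: eq_bigr => m' _ /=.
by rewrite !big_distrr.
Qed.

Lemma dtwist_dmul w1 w2 : dtwist (dmul w1 w2) = dmul (dtwist w1) (dtwist w2).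
Proof.
apply: funext => x; apply: funext => y; rewrite /dtwist /dmul big_distrr.
apply: eq_bigr => m _ /=; rewrite big_distrr; apply: eq_bigr => m' _ /=.
by rewrite (sign_mask_maskC (size_tuple m)); ring.
Qed.

(** Induction on the first list only: once it is empty, [dmul] is a [wedge] in the second list and
    [wedgeA] applies. *)
Lemma dmulA w1 w2 w3 : dmul w1 (dmul w2 w3) = dmul (dmul w1 w2) w3.
Proof.
apply: funext => x; apply: funext => y.
elim: x w1 w2 w3 => [|u x IH] w1 w2 w3.
  rewrite !dmul_nil.
  have dmulE w w' : dmul w w' [::] = wedge (w [::]) (w' [::]).
    by apply: funext => z; rewrite dmul_nil.
  by rewrite !dmulE wedgeA.
rewrite !dmul_cons.
have dmulE w w' : (fun z => dmul w w' (u :: z)) =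
    fun z t => dmul (fun z => w (u :: z)) w' z t +
               dmul (dtwist w) (fun z => w' (u :: z)) z t.
  by apply: funext => z; apply: funext => t; rewrite dmul_cons.
by rewrite !dmulE dmulDl dmulDr dtwist_dmul !IH addrA.
Qed.

Lemma dmul_dtensor a b c d :
  dmul (dtensor a b) (dtensor c d) = dtensor (wedge a c) (wedge b d).
Proof. by apply: funext => x; apply: funext => y; apply: dmul_tensor. Qed.

(** The common degree is left free, so products and powers need no degree bookkeeping. *)
Definition balanced w : Prop := forall x y, size x != size y -> w x y = 0.

Lemma balanced_dmul w1 w2 : balanced w1 -> balanced w2 -> balanced (dmul w1 w2).
Proof.
move=> b1 b2 x y nxy; rewrite /dmul big1 // => m _; rewrite big1 // => m' _.
have [e1|/b1->] := eqVneq (size (mask m x)) (size (mask m' y)); last first.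
  by rewrite mul0r mulr0.
have [e2|/b2->] := eqVneq (size (maskC m x)) (size (maskC m' y)); last first.
  by rewrite mulr0 mulr0.
by case/eqP: nxy; rewrite -(size_mask_maskC (size_tuple m)) e1 e2;
  apply: size_mask_maskC; rewrite size_tuple.
Qed.

Lemma balanced_dpow w k : balanced w -> balanced (dpow w k).
Proof.
move=> bw; elim: k => [|k IH]; last exact: balanced_dmul.
by case=> [|? ?] [|? ?].
Qed.

End DoubleForms.

(** * Gram forms, the metric and the Hodge star *)

Section Euclidean.
Context {R : realType} {V : vectType R} (g : {dot V for (@idfun R)}).
Implicit Types (w : dform V) (x y : seq V) (u v : V).

Definition flat u : Defs.form V := fun x => if x is [:: v] then g u v else 0.

Lemma flat_linear_form u x : size x != 1 -> flat u x = 0.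
Proof. by case: x => [|? []]. Qed.

Lemma gram_cons u x : gram g (u :: x) = wedge (flat u) (gram g x).
Proof.
apply: funext => z; rewrite wedge_linear_form; last exact: flat_linear_form.
have sz i : (i < size z)%N -> size (take i z ++ drop i.+1 z) = (size z).-1.
  move=> iz; rewrite size_cat size_take size_drop iz.
  by case: (size z) iz => // k; rewrite ltnS subSS; apply: subnKC.
rewrite /gram /=; have [xz|xz] := eqVneq; last first.
  (* Mismatched sizes: the left side is 0 by convention and so is each Gram factor on the right;
     [iz] makes [z] nonempty, so the predecessor is not truncated. *)
  rewrite big_nat big1 // => i /andP[_ iz]; rewrite sz //.
  case: eqP => [e|]; rewrite ?mulr0 //.
  by case/eqP: xz; rewrite e prednK // (leq_ltn_trans _ iz).
rewrite -xz big_mkord (expand_det_row _ ord0); apply: eq_bigr => i _.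
have iz : (i < size z)%N by rewrite -xz.
rewrite sz // -xz eqxx mxE /= mulrCA; congr (_ * _).
congr (_ * \det _); apply/matrixP => a b; rewrite !mxE /=; congr (g _ _).
(* Column [b] of the minor is column [bump i b] of the full matrix, just as deleting entry [i] of
   [z] shifts the later entries. *)
rewrite nth_cat size_take iz /bump; have [bi|ib] := ltnP b i.
  by rewrite nth_take.
by rewrite nth_drop addSn subnKC.
Qed.

Lemma dot_sym u v : g u v = g v u.
Proof. by rewrite hermC expr0 mul1r. Qed.

Lemma orthonormal_nth (s : seq V) (i j : nat) :
  orthonormal g s -> (i < size s)%N -> (j < size s)%N ->
  g s`_i s`_j = (i == j)%:R.
Proof.
rewrite /orthonormal; elim: s i j => [|u s IH] [|i] [|j] //=.
- by case/andP=> /andP[/eqP->].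
- rewrite andbT => /and3P[_ /allP us _] _ js.
  by apply/eqP/us/mem_nth.
- rewrite andbT => /and3P[_ /allP us _] si _.
  by rewrite dot_sym; apply/eqP/us/mem_nth.
- by case/andP=> /andP[_ us] /andP[_ ps]; apply: IH; rewrite us.
Qed.

(** Orthonormality identifies the coordinates of a vector with its inner products with [f]; then [u]
    is expanded by linearity. *)
Lemma parseval n (f : n.-tuple V) u v : orthonormal_basis g f ->
  \sum_(j < n) g (tnth f j) u * g (tnth f j) v = g u v.
Proof.
case=> fb fo.
have gf i j : g (tnth f i) (tnth f j) = (i == j)%:R.
  by rewrite !(tnth_nth 0) orthonormal_nth ?size_tuple.
have gfE j (z : V) : g (tnth f j) z = coord f j z.
  rewrite {1}(coord_basis fb (memvf z)) linear_sumr (bigD1 j) //=.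
  rewrite linearZr_LR -tnth_nth /= gf eqxx mulr1 big1 ?addr0 // => i ij.
  by rewrite linearZr_LR -tnth_nth /= gf eq_sym (negPf ij) mulr0.
rewrite {2}(coord_basis fb (memvf u)) linear_sumlz; apply: eq_bigr => j _.
by rewrite linearZl_LR -tnth_nth /= gfE.
Qed.

(** The left side does not mention [f]: this is why the contraction may use another basis than the
    Hodge star. *)
Lemma metric_dform_sum n (f : n.-tuple V) : orthonormal_basis g f ->
  metric_dform g =
  fun x y => \sum_(j < n) dtensor (flat (tnth f j)) (flat (tnth f j)) x y.
Proof.
move=> fo; apply: funext => x; apply: funext => y; rewrite /dtensor.
case: x => [|u [|? ?]] /=; try by rewrite big1 // => j _; rewrite mul0r.
case: y => [|v [|? ?]] /=; try by rewrite big1 // => j _; rewrite mulr0.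
by rewrite parseval.
Qed.

Lemma balanced_metric_dform : balanced (metric_dform g).
Proof. by case=> [|? [|? ?]] [|? [|? ?]]. Qed.

(** The coefficients, signs and complements listed by [hodge] are those of the shuffles in an
    exterior product evaluated on all of [e]. *)
Lemma dhodgeE n (e : n.-tuple V) w x y :
  dhodge g e w x y = dmul (dtensor (gram g x) (gram g y)) w e e.
Proof.
rewrite /dhodge /deval /hodge big_map big_enum /=.
(* Replacing [n] by [size e] gives both sums the same type of masks. *)
case: e => e /= /eqP; case: n / => /=.
apply: eq_bigr => m _; rewrite big_map big_enum /=.
apply: eq_bigr => m' _; rewrite /dtensor; ring.
Qed.

(** A nonzero term selects [size x] and [size y] vectors of [e]; if the complements have equal
    sizes, so do the selections. *)
Lemma balanced_dhodge n (e : n.-tuple V) w :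
  balanced w -> balanced (dhodge g e w).
Proof.
move=> bw x y nxy; rewrite dhodgeE /dmul big1 // => m _.
rewrite big1 // => m' _.
rewrite /dtensor /gram.
have [ex|_] := eqVneq (size x); last by rewrite !mul0r mulr0.
have [ey|_] := eqVneq (size y); last by rewrite mulr0 mul0r mulr0.
rewrite bw ?mulr0 //; apply: contraNneq nxy => exy; apply/eqP.
have me := size_mask_maskC (size_tuple m).
have := etrans me (esym (size_mask_maskC (size_tuple m'))).
rewrite -ex -ey exy; exact: addIn.
Qed.

Lemma twist_gram x : twist (gram g x) = fun z => (-1) ^+ size x * gram g x z.
Proof.
apply: funext => z; rewrite /twist /gram.
by case: eqP => [->|]; rewrite ?mulr0.
Qed.

Lemma contraction_dhodge n (e f : n.-tuple V) w x y :
  orthonormal_basis g f -> balanced w ->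
  contraction f (dhodge g e w) x y = dhodge g e (dmul (metric_dform g) w) x y.
Proof.
move=> fo bw; have [xy|xy] := eqVneq (size x) (size y); last first.
  rewrite (balanced_dhodge _ (balanced_dmul balanced_metric_dform bw)) //.
  by rewrite /contraction big1 // => j _; rewrite balanced_dhodge.
(* Associativity brings the metric next to the Gram forms, so that both sides become sums over [f]
   and compare termwise. *)
rewrite dhodgeE dmulA (metric_dform_sum fo) dmul_sumr dmul_suml.
apply: eq_bigr => j _; rewrite dhodgeE !gram_cons.
rewrite !(wedge_linear_formC _ (@flat_linear_form _)) !twist_gram !wedgeZl xy.
rewrite dmul_dtensor; congr (dmul _ w e e).
apply: funext => s; apply: funext => t; rewrite /dtensor mulrACA -exprD addnn.
by rewrite -mul2n exprM sqrrN !expr1n mul1r.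
Qed.

End Euclidean.

(** * Application to powers of the metric and of the given form *)

Lemma balanced_is_dform (R : comNzRingType) (V : lmodType R) (p : nat)
  (w : dform V) : is_dform p p w -> balanced w.
Proof.
case=> w0 _ _ x y nxy; apply: w0; apply: contraNN nxy.
by case/andP=> /eqP-> /eqP->.
Qed.

(* e fixes the orientation used by the Hodge star; f is the orthonormal basis
   used to compute the contraction. *)
Theorem proposition4p4 (R : realType) (V : vectType R)
  (g : {dot V for (@idfun R)}) (n : nat) (dimV : \dim {:V}%VS = n)
  (e f : n.-tuple V)
  (e_on : orthonormal_basis g e) (f_on : orthonormal_basis g f)
  (p q : nat) (p_ge1 : (1 <= p)%N) (q_gt0 : (0 < q)%N)
  (w : dform V) (w_form : is_dform p p w)
  (w_sym : dsymmetric w) (w_bianchi : first_bianchi p w)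
  (r : nat) (r_ge1 : (1 <= r)%N) (r_le : (r + p * q <= n)%N)
  (x y : seq V) :
  contraction f (h_form g e p q w r) x y =
  dscale (n - p * q - r + 1)%:R (h_form g e p q w r.-1) x y.
Proof.
have bw := balanced_is_dform w_form.
rewrite /h_form; set k := (n - p * q - r)%N.
(* Here [r_ge1] and [r_le] ensure that no subtraction is truncated. *)
have -> : (n - p * q - r.-1)%N = k.+1.
  by rewrite /k -{2}(prednK r_ge1) subnSK // ltn_subRL addnC -addSn prednK.
have bgk : balanced (dmul (dpow (metric_dform g) k) (dpow w q)).
  apply: balanced_dmul; apply: balanced_dpow => //.
  exact: balanced_metric_dform.
rewrite contraction_dhodge //; last by move=> s t st; rewrite /dscale bgk ?mulr0.
(* The metric factor joins the [k] others, as [dpow] multiplies on the left; what remains is that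
   the inverse of [k]! is [k.+1] times the inverse of [k.+1]!. *)
rewrite dmulZr dmulA -/(dpow _ k.+1) /dscale !dhodgeE !dmulZr /dscale addn1.
rewrite factS natrM mulrA invfM mulrA divff ?mul1r //.
by rewrite pnatr_eq0.
Qed.
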